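(* Let $y^*,y\in\{1,\dots,K\}$ be two classes and $\mathbf c=\mathbf e_{y^*}-\mathbf e_y\in\mathbb R^K$. Define the exact worst-case margin $$m^t(y^*,y)=\min_{\tilde X\in\mathcal X_{q,Q}(\dot X)} f^t_\theta(\tilde X,\dot A)_{y^*}-f^t_\theta(\tilde X,\dot A)_{y}$$ and the relaxed margin $$\tilde m^t(y^*,y)=\min_{\tilde X,H^{(\cdot)},\hat H^{(\cdot)}} \mathbf c^\top \hat H^{(L)}\quad\text{subject to}\quad \tilde X\in\mathcal X_{q,Q}(\dot X),\ [H^{(\cdot)},\hat H^{(\cdot)}]\in\mathcal Z_{q,Q}(\tilde X).$$ Then $\tilde m^t(y^*,y)\le m^t(y^*,y)$.
   Context: Setting. $G$ is a graph on $N$ nodes with binary node feature matrix $X\in\{0,1\}^{N\times D}$. A graph neural network with $L$ layers is given by real message passing matrices $\hat A^{(l)}\in\mathbb R^{N\times N}$ ($l=1,\dots,L-1$; entry $(u,v)$ is zero unless $v$ is $u$ itself or a neighbor of $u$), weights $W^{(l)}\in\mathbb R^{h^{(l)}\times h^{(l+1)}}$ and biases $b^{(l)}\in\mathbb R^{h^{(l+1)}}$ (added to every row), with $h^{(1)}=D$, $h^{(L)}=K$ (number of classes); $\theta$ denotes all weights and biases. Fix a target node $t$. $\mathcal N_l(t)$ is the set of nodes reachable from $t$ in at most $l$ hops (including $t$); write $\mathcal N_l=\mathcal N_l(t)$. Slices: $\dot X=X_{\mathcal N_{L-1}:}$ (rows indexed by $\mathcal N_{L-1}$), and $\dot A^{(l)}=\hat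 A^{(l)}_{\mathcal N_{L-l-1},\mathcal N_{L-l}}$ (rows, columns) for $l=1,\dots,L-1$. Exact network. For an input $\tilde X$ with rows indexed by $\mathcal N_{L-1}$, put $H^{(1)}=\tilde X$, (i) $\hat H^{(l)}=\dot A^{(l-1)}H^{(l-1)}W^{(l-1)}+b^{(l-1)}$ for $l=2,\dots,L$, (ii) $H^{(l)}_{nj}=\max\{\hat H^{(l)}_{nj},0\}$ for $l=2,\dots,L-1$. $\hat H^{(L)}$ has a single row, regarded as a vector in $\mathbb R^K$, and $f^t_\theta(\tilde X,\dot A):=\hat H^{(L)}$. Admissible perturbations, for budgets $q,Q\in\mathbb N$: $\mathcal X_{q,Q}(\dot X)$ is the set of $\tilde X$ with entries in $\{0,1\}$, $\|\tilde X-\dot X\|_0\le Q$, and $\|\tilde X_{n:}-\dot X_{n:}\|_0\le q$ for all $n\in\mathcal N_{L-1}$ (entry-wise norms). Activation bounds. For $l=2,\dots,L-1$ real matrices $R^{(l)},S^{(l)}$ are given that are lower/upper bounds on the ReLU inputs under the admissible perturbations: $R^{(l)}_{nj}\le\hat H^{(l)}_{nj}\le S^{(l)}_{nj}$ for the exact network applied to any $\tilde X\in\mathcal X_{q,Q}(\dot X)$. Let $\mathcal I^{(l)}$ be the set of $(n,j)$ with $R^{(l)}_{nj}<0<S^{(l)}_{nj}$, $\mathcal I_+^{(l)}$ those for which both bounds are nonnegative, $\mathcal I_-^{(l)}$ those for which both are nonpositive. Relaxed network. $\mathcal Z_{q,Q}(\tilde X)$ is the set of collections of real matrices $[H^{(\cdot)},\hat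 H^{(\cdot)}]$ with $H^{(1)}=\tilde X$ satisfying the linear equations (i) for $l=2,\dots,L$ and, for $l=2,\dots,L-1$: $H^{(l)}_{nj}=\hat H^{(l)}_{nj}$ if $(n,j)\in\mathcal I_+^{(l)}$; $H^{(l)}_{nj}=0$ if $(n,j)\in\mathcal I_-^{(l)}$; and if $(n,j)\in\mathcal I^{(l)}$: $H^{(l)}_{nj}\ge\hat H^{(l)}_{nj}$, $H^{(l)}_{nj}\ge0$, $H^{(l)}_{nj}(S^{(l)}_{nj}-R^{(l)}_{nj})\le S^{(l)}_{nj}(\hat H^{(l)}_{nj}-R^{(l)}_{nj})$. *)

(* Defs.v *)
From HB Require Import structures.
From mathcomp Require Import all_boot all_order all_algebra.
From mathcomp Require Import all_classical all_reals.
Set Implicit Arguments.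
Unset Strict Implicit.
Unset Printing Implicit Defensive.
Import Order.TTheory GRing.Theory Num.Theory.
Local Open Scope classical_set_scope.
Local Open Scope ring_scope.

Definition nbhd (N : nat) (adj : rel 'I_N) (t : 'I_N) (l : nat) : {set 'I_N} :=
  [set v | [exists k : 'I_l.+1,
     [exists p : k.-tuple 'I_N, path adj t p && (last t p == v)]]]%SET.

Lemma nbhd_self (N : nat) (adj : rel 'I_N) (t : 'I_N) (l : nat) :
  t \in nbhd adj t l.
Proof.
rewrite inE; apply/existsP; exists ord0; apply/existsP.
by exists [tuple]; rewrite /= eqxx.
Qed.

(* Number of rows of the matrices of layer l.  Their i-th row belongs to the
   node enum_val i of nbhd adj t (L - l). *)
Definition nrows (N : nat) (adj : rel 'I_N) (t : 'I_N) (L l : nat) : nat :=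
  #|nbhd adj t (L - l)|.

Definition message_passing (R : realType) (N : nat) (adj : rel 'I_N)
    (A : 'M[R]_N) : Prop :=
  forall u v, ~~ ((v == u) || adj u v) -> A u v = 0.

Definition binary (R : realType) (m n : nat) (X : 'M[R]_(m, n)) : Prop :=
  forall i j, X i j = 0 \/ X i j = 1.

Definition norm0 (R : realType) (m n : nat) (X : 'M[R]_(m, n)) : nat :=
  #|[set ij : 'I_m * 'I_n | X ij.1 ij.2 != 0]%SET|.

Definition admissible (R : realType) (m n : nat) (q Q : nat)
    (Xdot : 'M[R]_(m, n)) : set 'M[R]_(m, n) :=
  [set X | [/\ binary X, (norm0 (X - Xdot) <= Q)%N &
               forall i, (norm0 (row i X - row i Xdot)%R <= q)%N]].

Definition slice_features (R : realType) (N : nat) (adj : rel 'I_N)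
    (t : 'I_N) (L D : nat) (X : 'M[R]_(N, D)) :
    'M[R]_(nrows adj t L 1%N, D) :=
  rowsub (fun i => enum_val i) X.

Definition slice_messages (R : realType) (N : nat) (adj : rel 'I_N)
    (t : 'I_N) (L : nat) (A : nat -> 'M[R]_N) (l : nat) :
    'M[R]_(nrows adj t L l.+1, nrows adj t L l) :=
  mxsub (fun i => enum_val i) (fun j => enum_val j) (A l).

(* h l is the width of layer l.  Layers are numbered from 1; families over nat
   also have entries outside the range of the layers, which are never used. *)
Record params (R : realType) (h : nat -> nat) := Params {
  weight : forall l, 'M[R]_(h l, h l.+1);
  bias : forall l, 'rV[R]_(h l.+1) }.

Section Network.
Variables (R : realType) (N : nat) (adj : rel 'I_N) (t : 'I_N) (L : nat).
Variables (h : nat -> nat) (theta : params R h).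

Local Notation m := (nrows adj t L).

Variable Adot : forall l, 'M[R]_(m l.+1, m l).

Definition affine (l : nat) (H : 'M[R]_(m l, h l)) : 'M[R]_(m l.+1, h l.+1) :=
  Adot l *m H *m weight theta l + \matrix_(i, j) bias theta l 0 j.

(* H^(l) from the preactivation of layer l; layer 1 is the input itself. *)
Definition activate (X : 'M[R]_(m 1%N, h 1%N)) (l : nat) :
    'M[R]_(m l, h l) -> 'M[R]_(m l, h l) :=
  match l return 'M[R]_(m l, h l) -> 'M[R]_(m l, h l) with
  | 1%N => fun _ => X
  | _ => map_mx (fun x => Num.max x 0)
  end.

Fixpoint preact (X : 'M[R]_(m 1%N, h 1%N)) (l : nat) : 'M[R]_(m l, h l) :=
  match l return 'M[R]_(m l, h l) with
  | 0%N => 0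
  | k.+1 => affine (activate X (preact X k))
  end.

(* nbhd adj t (L - L) is the singleton of t, so this is the only row. *)
Definition target_row (M : 'M[R]_(m L, h L)) : 'rV[R]_(h L) :=
  row (enum_rank_in (nbhd_self adj t (L - L)) t) M.

Definition gnn (X : 'M[R]_(m 1%N, h 1%N)) : 'rV[R]_(h L) :=
  target_row (preact X L).

Definition valid_bounds (q Q : nat) (Xdot : 'M[R]_(m 1%N, h 1%N))
    (lo up : forall l, 'M[R]_(m l, h l)) : Prop :=
  forall l, (2 <= l < L)%N -> forall X, admissible q Q Xdot X ->
  forall n j, lo l n j <= preact X l n j <= up l n j.

(* The active and inactive cases overlap when both bounds are 0; both
   constraints then apply. *)
Definition relaxed_relu (lo up x y : R) : Prop :=
  [/\ 0 <= lo /\ 0 <= up -> y = x,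
      lo <= 0 /\ up <= 0 -> y = 0 &
      lo < 0 < up -> [/\ x <= y, 0 <= y & y * (up - lo) <= up * (x - lo)]].

Definition relaxation (lo up : forall l, 'M[R]_(m l, h l))
    (X : 'M[R]_(m 1%N, h 1%N)) (H Hhat : forall l, 'M[R]_(m l, h l)) : Prop :=
  [/\ H 1%N = X,
      forall l, (1 <= l < L)%N -> Hhat l.+1 = affine (H l) &
      forall l, (2 <= l < L)%N -> forall n j,
        relaxed_relu (lo l n j) (up l n j) (Hhat l n j) (H l n j)].

Definition exact_values (q Q : nat) (Xdot : 'M[R]_(m 1%N, h 1%N))
    (ystar y : 'I_(h L)) : set R :=
  [set gnn X 0 ystar - gnn X 0 y | X in admissible q Q Xdot].

Definition relaxed_values (q Q : nat) (Xdot : 'M[R]_(m 1%N, h 1%N))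
    (lo up : forall l, 'M[R]_(m l, h l)) (c : 'cV[R]_(h L)) : set R :=
  [set r | exists X H Hhat, [/\ admissible q Q Xdot X,
     relaxation lo up X H Hhat &
     r = (c^T *m (target_row (Hhat L))^T) 0 0]].

End Network.

Definition is_min (R : realType) (A : set R) (x : R) : Prop :=
  A x /\ lbound A x.

(* Main.v *)
(** Every exact ReLU evaluation of an admissible input satisfies the relaxed
    constraints, so the relaxed problem minimizes over a larger set of values;
    the work is in showing that both minima are attained.  There are finitely
    many admissible inputs.  For a fixed one, the relaxed constraints are
    closed, and they bound the activations layer by layer: valid bounds satisfy
    [lo <= up], and then each relaxed unit is the identity, zero, or confined
    to a triangle whose height is controlled by its input.  By Tychonoff the
    feasible activations are compact, and the margin is continuous in them. *)

Require Import Defs.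
From HB Require Import structures.
From mathcomp Require Import all_boot all_order all_algebra.
From mathcomp Require Import all_classical all_reals.
From mathcomp Require Import topology normedtype derive.
Set Implicit Arguments.
Unset Strict Implicit.
Unset Printing Implicit Defensive.
Import Order.TTheory GRing.Theory Num.Theory.
Import numFieldNormedType.Exports.
Local Open Scope classical_set_scope.
Local Open Scope ring_scope.

(** * Minima over finite sets and finite unions *)

Lemma finite_minimum (R : realType) (T : choiceType) (D : set T) (g : T -> R) :
  finite_set D -> D !=set0 -> exists2 x, D x & forall y, D y -> g x <= g y.
Proof.
move=> /finite_seqP[s ->] [x0 /= x0s].
pose i0 : seq_sub s := SeqSub x0s.
case: (@arg_minP _ _ _ i0 xpredT (fun i => g (val i)) isT) => i _ imin.
exists (val i); first exact: valP.
by move=> y ys; have := imin (SeqSub ys) isT.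
Qed.

Lemma finite_bigcup_min (R : realType) (T : choiceType) (D : set T)
    (F : T -> set R) :
  finite_set D -> D !=set0 -> (forall x, D x -> exists a, is_min (F x) a) ->
  exists a, is_min (\bigcup_(x in D) F x) a.
Proof.
move=> finD D0 minF.
have /choice[g gP] : forall x, exists a, D x -> is_min (F x) a.
  (* The value 0 outside [D] is a dummy that makes the choice function total. *)
  by move=> x; have [/minF[a ?]|] := pselect (D x); [exists a|exists 0].
have [x Dx xmin] := finite_minimum g finD D0.
have [Fgx _] := gP _ Dx.
exists (g x); split => [|a [z Dz Fza]]; first by exists x.
by have [_ gz] := gP _ Dz; exact: le_trans (xmin _ Dz) (gz _ Fza).
Qed.

(** * The constraint on a single relaxed ReLU unit *)

Section Relaxed_relu.
Variable R : realType.
Implicit Types lo up x y : R.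

(** When [lo < 0 < up], the last inequality says that the point lies below the chord from [(lo, 0)]
    to [(up, up)]; a convex function lies below its chords. *)
Lemma relaxed_relu_max lo up x :
  lo <= x <= up -> relaxed_relu lo up x (Num.max x 0).
Proof.
move=> /andP[lox xup]; split.
- by move=> [lo0 _]; rewrite max_l // (le_trans lo0).
- by move=> [_ up0]; rewrite max_r // (le_trans xup).
- move=> /andP[lo0 up0]; have [x0|x0] := leP x 0; split; rewrite ?(ltW x0)//.
    by rewrite mul0r mulr_ge0 ?subr_ge0// ltW.
  (* After cancelling [x * up] the claim is [up * lo <= x * lo], that is [x <= up], since
     [lo < 0]. *)
  rewrite !mulrBr mulrC lerD2l lerN2 mulrC [leRHS]mulrC.
  by rewrite ler_nM2l.
Qed.

(** Since [lo <= up], one of the three cases always applies; for [up < 0 < lo] the output [y] would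
    be unconstrained. *)
Lemma relaxed_relu_bounded lo up B :
  lo <= up -> exists C, forall x y,
    `|x| <= B -> relaxed_relu lo up x y -> `|y| <= C.
Proof.
move=> loup; have [lo0|lo0] := leP 0 lo.
  exists B => x y xB [-> //]; split => //; exact: le_trans loup.
have [up0|up0] := leP up 0.
  by exists 0 => x y _ [_ -> //]; rewrite ?normr0//; split => //; exact: ltW.
(* This is the height of the chord at the largest input [B]. *)
exists (up * (B - lo) / (up - lo)) => x y xB [_ _ []]; first by rewrite lo0.
move=> xy y0 yup; rewrite ger0_norm// ler_pdivlMr ?subr_gt0 ?(lt_trans lo0)//.
apply: le_trans yup _; rewrite ler_pM2l// lerD2r.
exact: le_trans (ler_norm x) xB.
Qed.

Lemma closed_le_continuous (T : topologicalType) (f g : T -> R) :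
  continuous f -> continuous g -> closed [set p | f p <= g p].
Proof.
move=> cf cg; have -> : [set p | f p <= g p] =
    (fun p => g p - f p) @^-1` [set x | 0 <= x].
  by apply/seteqP; split => p /=; rewrite subr_ge0.
apply: preimage_closed; last exact: closed_ge.
by move=> p _; apply: cvgB; [exact: cg|exact: cf].
Qed.

Lemma closed_eq_continuous (T : topologicalType) (f g : T -> R) :
  continuous f -> continuous g -> closed [set p | f p = g p].
Proof.
move=> cf cg; have -> : [set p | f p = g p] =
    [set p | f p <= g p] `&` [set p | g p <= f p].
  apply/seteqP; split => p /= => [->//|[fg gf]].
  by apply/eqP; rewrite eq_le fg gf.
by apply: closedI; exact: closed_le_continuous.
Qed.

(** The premise does not depend on the point, so the set is either [A] or the whole space. *)
Lemma closed_imply (T : topologicalType) (P : Prop) (A : set T) :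
  closed A -> closed [set p | P -> A p].
Proof.
move=> clA; have [p|np] := pselect P.
  by rewrite [X in closed X](_ : _ = A)//; apply/seteqP; split => x /=; auto.
rewrite [X in closed X](_ : _ = setT); first exact: closedT.
by apply/seteqP; split => x /=.
Qed.

Lemma closed_forall (T : topologicalType) (I : Type) (A : I -> set T) :
  (forall i, closed (A i)) -> closed [set p | forall i, A i p].
Proof.
move=> clA; rewrite [X in closed X](_ : _ = \bigcap_(i in setT) A i).
  by apply: closed_bigI => i _.
by apply/seteqP; split => [p Ap i _|p Ap i]; exact: Ap.
Qed.

Lemma closed_relaxed_relu (T : topologicalType) lo up (f g : T -> R) :
  continuous f -> continuous g ->
  closed [set p | relaxed_relu lo up (f p) (g p)].
Proof.
move=> cf cg.
rewrite [X in closed X](_ : _ =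
    [set p | 0 <= lo /\ 0 <= up -> g p = f p] `&`
    [set p | lo <= 0 /\ up <= 0 -> g p = 0] `&`
    [set p | lo < 0 < up -> ([set p | f p <= g p] `&` [set p | 0 <= g p] `&`
       [set p | g p * (up - lo) <= up * (f p - lo)]) p]); last first.
  apply/seteqP; split => p /=.
    by move=> [? ? H3]; split => // /H3[].
  by move=> [[? ?] H3]; split => // /H3[[]].
have cc (a : R) : continuous (fun _ : T => a) by exact: cst_continuous.
apply: closedI; first apply: closedI.
- by apply: closed_imply; exact: closed_eq_continuous.
- by apply: closed_imply; exact: closed_eq_continuous.
apply: closed_imply; apply: closedI; first apply: closedI.
- exact: closed_le_continuous.
- exact: closed_le_continuous.
apply: closed_le_continuous => p.
  by apply: cvgM; [exact: cg|exact: cc].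
by apply: cvgM; [exact: cc|apply: cvgB; [exact: cf|exact: cc]].
Qed.

End Relaxed_relu.

(** * Finite sums, and finiteness of the set of binary matrices *)

Lemma continuous_bigsum (R : realType) (T : topologicalType) (I : Type)
    (r : seq I) (f : I -> T -> R) :
  (forall i, continuous (f i)) -> continuous (fun p => \sum_(i <- r) f i p).
Proof.
move=> cf; elim: r => [|i r IHr].
  by under eq_fun do rewrite big_nil; move=> p; exact: cvg_cst.
under eq_fun do rewrite big_cons.
by move=> p; apply: cvgD; [exact: cf|exact: IHr].
Qed.

Lemma bounded_bigsum (R : realType) (T I : Type) (P : set T) (r : seq I)
    (f : I -> T -> R) :
  (forall i, exists b, forall p, P p -> `|f i p| <= b) ->
  exists b, forall p, P p -> `|\sum_(i <- r) f i p| <= b.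
Proof.
move=> /choice[b fb]; exists (\sum_(i <- r) b i) => p Pp.
by apply: le_trans (ler_norm_sum _ _ _) _; apply: ler_sum => i _; exact: fb.
Qed.

Lemma finite_binary (R : realType) (m n : nat) :
  finite_set [set X : 'M[R]_(m, n) | binary X].
Proof.
pose of_bool (B : 'M[bool]_(m, n)) : 'M[R]_(m, n) := map_mx (fun b : bool => b%:R) B.
apply: (@sub_finite_set _ _ (of_bool @` setT)); last first.
  exact/finite_image/finite_finset.
move=> X bX; exists (map_mx (fun x => x == 1) X) => //.
apply/matrixP => i j; rewrite !mxE.
by case: (bX i j) => ->; rewrite ?eqxx // eq_sym oner_eq0.
Qed.

(** * Compactness of the feasible activations and attainment for a fixed input *)

Section Relaxed_network.
Variables (R : realType) (N : nat) (adj : rel 'I_N) (t : 'I_N) (L : nat).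
Variables (h : nat -> nat) (theta : params R h).
Local Notation m := (nrows adj t L).
Variable Adot : forall l, 'M[R]_(m l.+1, m l).
Variables (lo up : forall l, 'M[R]_(m l, h l)).
Implicit Types X : 'M[R]_(m 1%N, h 1%N).

Lemma affineE l (H : 'M[R]_(m l, h l)) i j :
  affine theta Adot H i j =
  \sum_k (\sum_n Adot l i n * H n k) * weight theta l k j + bias theta l 0 j.
Proof.
by rewrite !mxE; congr (_ + _); apply: eq_bigr => k _; rewrite mxE.
Qed.

Lemma continuous_affine (T : topologicalType) l (H : T -> 'M[R]_(m l, h l)) :
  (forall i j, continuous (fun p => H p i j)) ->
  forall i j, continuous (fun p => affine theta Adot (H p) i j).
Proof.
move=> cH i j; under eq_fun do rewrite affineE.
move=> p; apply: cvgD; last exact: cvg_cst.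
apply: continuous_bigsum => k {}p; apply: cvgM; last exact: cvg_cst.
apply: continuous_bigsum => n {}p; apply: cvgM; first exact: cvg_cst.
exact: cH.
Qed.

Lemma bounded_affine (T : Type) (P : set T) l (H : T -> 'M[R]_(m l, h l)) :
  (forall i j, exists b, forall p, P p -> `|H p i j| <= b) ->
  forall i j, exists b, forall p, P p -> `|affine theta Adot (H p) i j| <= b.
Proof.
move=> bH i j.
have [b bP] : exists b, forall p, P p ->
    `|\sum_k (\sum_n Adot l i n * H p n k) * weight theta l k j| <= b.
  apply: bounded_bigsum => k.
  have [b bP] : exists b, forall p, P p -> `|\sum_n Adot l i n * H p n k| <= b.
    apply: bounded_bigsum => n; have [b bP] := bH n k.
    by exists (`|Adot l i n| * b) => p /bP ?; rewrite normrM ler_wpM2l.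
  by exists (b * `|weight theta l k j|) => p /bP ?; rewrite normrM ler_wpM2r.
exists (b + `|bias theta l 0 j|) => p /bP ?.
by rewrite affineE (le_trans (ler_normD _ _)) // lerD2r.
Qed.

(** In a relaxation the activations [H] determine [Hhat] on layers 2 to [L], so [Hhat] can be
    eliminated. Unlike in [preact], the activations here are free variables. *)
Definition preact_of (H : forall l, 'M[R]_(m l, h l)) l : 'M[R]_(m l, h l) :=
  match l with 0%N => 0 | k.+1 => affine theta Adot (H k) end.

(** The family of matrices is flattened to one real function on all units, with the topology of
    pointwise convergence, so that Tychonoff's theorem applies. *)
Local Notation unit_index := {l : nat & ('I_(m l) * 'I_(h l))%type}.
Local Notation activations := {ptws unit_index -> R}.

Definition layer (f : activations) l : 'M[R]_(m l, h l) :=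
  \matrix_(i, j) f (existT _ l (i, j)).

(* Activations outside the layers 1, ..., L - 1 are unconstrained in a
   relaxation; they are set to 0 here so that the set is compact. *)
Definition feasible X : set activations :=
  [set f | [/\ layer f 1%N = X,
    forall l, (2 <= l < L)%N -> forall n j,
      relaxed_relu (lo l n j) (up l n j)
        (preact_of (layer f) l n j) (layer f l n j) &
    forall l, ~~ (1 <= l < L)%N -> layer f l = 0]].

Lemma continuous_layer l i j : continuous (fun f => layer f l i j).
Proof.
have -> : (fun f => layer f l i j) = (fun f => f (existT _ l (i, j))).
  by apply/funext => f; rewrite mxE.
exact: (@proj_continuous _ (fun=> R)).
Qed.

Lemma continuous_preact_of l i j :
  continuous (fun f => preact_of (layer f) l i j).
Proof.
case: l i j => [|l] i j /=; last first.
  by apply: continuous_affine => *; exact: continuous_layer.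
exact: cst_continuous.
Qed.

Lemma closed_layer_eq l (M : 'M[R]_(m l, h l)) : closed [set f | layer f l = M].
Proof.
rewrite [X in closed X](_ : _ = [set f | forall i j, layer f l i j = M i j]).
  apply: closed_forall => i; apply: closed_forall => j.
  by apply: closed_eq_continuous; [exact: continuous_layer|exact: cst_continuous].
by apply/seteqP; split => f /= => [->|fM] //; apply/matrixP.
Qed.

Lemma closed_feasible X : closed (feasible X).
Proof.
rewrite [Y in closed Y](_ : _ = [set f | layer f 1%N = X] `&`
  [set f | forall l, (2 <= l < L)%N -> forall n j,
      relaxed_relu (lo l n j) (up l n j)
        (preact_of (layer f) l n j) (layer f l n j)] `&`
  [set f | forall l, ~~ (1 <= l < L)%N -> layer f l = 0]); last first.
  by apply/seteqP; split => f /= [// []].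
apply: closedI; first apply: closedI.
- exact: closed_layer_eq.
- apply: closed_forall => l; apply: closed_imply.
  apply: closed_forall => n; apply: closed_forall => j.
  apply: closed_relaxed_relu; first exact: continuous_preact_of.
  exact: continuous_layer.
- apply: closed_forall => l; apply: closed_imply; exact: closed_layer_eq.
Qed.

Hypothesis lo_le_up : forall l, (2 <= l < L)%N -> forall n j, lo l n j <= up l n j.

(** Induction on the layer: layer 1 is the fixed input, layers outside the range vanish, and
    elsewhere a bound on one layer passes through the affine map and then through the relaxed
    unit. *)
Lemma bounded_feasible X l i j :
  exists b, forall f, feasible X f -> `|layer f l i j| <= b.
Proof.
elim: l i j => [|l IHl] i j.
  by exists 0 => f [_ _ /(_ 0%N)->//]; rewrite mxE normr0.
have [l0|l0] := posnP l.
  by subst l; exists `|X i j| => f [-> _ _].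
have [lL|lL] := ltnP l.+1 L; last first.
  by exists 0 => f [_ _ ->]; rewrite ?mxE ?normr0// -leqNgt.
have lr : (2 <= l.+1 < L)%N by rewrite ltnS l0.
have [b bP] := bounded_affine IHl i j.
have [C CP] := relaxed_relu_bounded b (lo_le_up lr i j).
by exists C => f Ff; apply: CP (bP _ Ff) _; case: Ff => _ /(_ _ lr i j).
Qed.

Lemma compact_feasible X : compact (feasible X).
Proof.
have /choice[b bP] : forall u : unit_index,
    exists b, forall f, feasible X f -> `|f u| <= b.
  move=> [l [i j]]; have [b bP] := bounded_feasible X i j.
  by exists b => f /bP; rewrite mxE.
apply: (@subclosed_compact _ _
    [set f : activations | forall u, `[- b u, b u]%classic (f u)]).
- exact: closed_feasible.
- apply: (@tychonoff _ (fun=> R) (fun u => `[- b u, b u]%classic)) => u.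
  exact: segment_compact.
- by move=> f Ff u; rewrite /= in_itv /= -ler_norml; exact: bP.
Qed.

Definition relaxed_values_at (c : 'cV[R]_(h L)) X : set R :=
  [set r | exists H Hhat, relaxation theta Adot lo up X H Hhat /\
    r = (c^T *m (target_row (Hhat L))^T) 0 0].

(** The extreme value theorem on the feasible set. As [2 <= L], the output is an affine image of
    layer [L - 1], which is among the constrained layers. *)
Lemma relaxed_values_at_min (c : 'cV[R]_(h L)) X : (2 <= L)%N ->
  relaxed_values_at c X !=set0 -> exists a, is_min (relaxed_values_at c X) a.
Proof.
move=> L2.
pose g f := (c^T *m (target_row (preact_of (layer f) L))^T) 0 0.
have -> : relaxed_values_at c X = g @` feasible X.
  apply/seteqP; split => [r [H [Hhat [[H1 HhatE rel] ->]]]|r [f [f1 frel f0] <-]].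
    (* Truncating [H] to layers 1 to [L - 1] makes it feasible and leaves the margin unchanged. *)
    pose f : activations := fun u =>
      if (1 <= projT1 u < L)%N then H (projT1 u) (projT2 u).1 (projT2 u).2 else 0.
    have fH l : (1 <= l < L)%N -> layer f l = H l.
      by move=> lL; apply/matrixP => i j; rewrite mxE /f /= lL.
    have pH l : (2 <= l <= L)%N -> preact_of (layer f) l = Hhat l.
      by case: l => // l lL /=; rewrite HhatE // fH.
    exists f; last by rewrite /g pH // L2 leqnn.
    split; first by rewrite fH.
    - move=> l /andP[l2 lL] n j; rewrite pH ?l2 ?(ltnW lL)//.
      by rewrite fH ?(ltnW l2)//; apply: rel; rewrite l2.
    - by move=> l lL; apply/matrixP => i j; rewrite !mxE /f /= (negbTE lL).
  by exists (layer f), (preact_of (layer f)); split.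
case=> _ [f0 Ff0 _]; have nf : feasible X !=set0 by exists f0.
have cg : continuous g.
  (* The margin is a fixed linear combination of the entries of the output row. *)
  have -> : g = fun f => \sum_k c k 0 * preact_of (layer f) L
      (enum_rank_in (nbhd_self adj t (L - L)) t) k.
    by apply/funext => f; rewrite /g mxE; apply: eq_bigr => k _; rewrite !mxE.
  apply: continuous_bigsum => k f.
  by apply: continuousM; [exact: cst_continuous|exact: continuous_preact_of].
have [f /set_mem Ff fmin] := compact_EVT_min nf (@compact_feasible X)
  (continuous_subspaceT cg).
exists (g f); split; first by exists f.
by move=> _ [f' Ff' <-]; apply/fmin/mem_set.
Qed.

Lemma relaxation_preact X :
  (forall l, (2 <= l < L)%N -> forall n j,
     lo l n j <= preact theta Adot X l n j <= up l n j) ->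
  relaxation theta Adot lo up X
    (fun l => activate X (preact theta Adot X l)) (preact theta Adot X).
Proof.
(* The range excludes layers 0 and 1; from layer 2 on, [activate] is the entrywise maximum with
   0. *)
move=> bX; split => // -[|[|l]] // lL n j.
by rewrite [activate _ _ _ _]mxE; apply: relaxed_relu_max; exact: bX.
Qed.

End Relaxed_network.

(** * Comparison of the two margins *)

Lemma margin_delta (R : realType) (k : nat) (y1 y2 : 'I_k) (v : 'rV[R]_k) :
  ((delta_mx y1 0 - delta_mx y2 0 : 'cV[R]_k)^T *m v^T) 0 0 = v 0 y1 - v 0 y2.
Proof.
by rewrite linearB /= !trmx_delta mulmxBl -!rowE !mxE.
Qed.

Theorem corollary4p1 (R : realType) (N : nat) (adj : rel 'I_N) (t : 'I_N)
    (L : nat) (hL : (2 <= L)%N) (h : nat -> nat)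
    (X : 'M[R]_(N, h 1%N)) (hX : binary X)
    (A : nat -> 'M[R]_N)
    (hA : forall l, (1 <= l < L)%N -> message_passing adj (A l))
    (theta : params R h) (q Q : nat)
    (lo up : forall l, 'M[R]_(nrows adj t L l, h l))
    (hbounds : valid_bounds theta (slice_messages adj t L A) q Q
                 (slice_features adj t L X) lo up)
    (ystar y : 'I_(h L)) :
  let Xdot := slice_features adj t L X in
  let Adot := slice_messages adj t L A in
  let c : 'cV[R]_(h L) := delta_mx ystar 0 - delta_mx y 0 in
  exists m mrelaxed : R,
    [/\ is_min (exact_values theta Adot q Q Xdot ystar y) m,
        is_min (relaxed_values theta Adot q Q Xdot lo up c) mrelaxed &
        mrelaxed <= m].
Proof.
move=> Xdot Adot c.
have finX : finite_set (admissible q Q Xdot).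
  by apply: sub_finite_set (finite_binary R _ _) => ? [].
have norm00 k n : norm0 (0 : 'M[R]_(k, n)) = 0%N.
  by apply: eq_card0 => ij; rewrite !inE mxE eqxx.
(* The zero perturbation meets every budget. *)
have admXdot : admissible q Q Xdot Xdot.
  split=> [i j||i]; rewrite ?subrr ?norm00//.
  by rewrite mxE; exact: hX.
have adm0 : admissible q Q Xdot !=set0 by exists Xdot.
(* Both bounds enclose the exact preactivation of the unperturbed input. *)
have lo_le_up l : (2 <= l < L)%N -> forall n j, lo l n j <= up l n j.
  move=> lL n j; have /andP[] := hbounds l lL _ admXdot n j.
  exact: le_trans.
(* This serves twice: it makes the relaxed problem at [Y] nonempty, and it yields the final
   inequality at an exact minimizer. *)
have feas Y : admissible q Q Xdot Y ->
    relaxed_values_at theta Adot lo up c Y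
      (gnn theta Adot Y 0 ystar - gnn theta Adot Y 0 y).
  move=> admY; exists (fun l => activate Y (preact theta Adot Y l)).
  exists (preact theta Adot Y); split; last by rewrite margin_delta.
  by apply: relaxation_preact => l lL n j; exact: hbounds.
have [m [[Y admY mE] mmin]] :
    exists m, is_min (exact_values theta Adot q Q Xdot ystar y) m.
  have [Y admY Ymin] := finite_minimum
    (fun Y => gnn theta Adot Y 0 ystar - gnn theta Adot Y 0 y) finX adm0.
  eexists; split; first by exists Y.
  by move=> _ [Z admZ <-]; exact: Ymin.
(* Minimizing over inputs is separated from minimizing over activations. *)
have relE : relaxed_values theta Adot q Q Xdot lo up c =
    \bigcup_(Z in admissible q Q Xdot) relaxed_values_at theta Adot lo up c Z.
  apply/seteqP; split => [r [Z [H [Hhat [admZ rel rE]]]]|r [Z admZ [H [Hhat [rel rE]]]]].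
    by exists Z => //; exists H, Hhat.
  by exists Z, H, Hhat.
have [mr mrP] := finite_bigcup_min finX adm0 (fun Z admZ =>
  relaxed_values_at_min lo_le_up hL (ex_intro _ _ (feas Z admZ))).
exists m, mr; rewrite relE; split => //.
  by split => //; exists Y.
by case: mrP => _; apply; exists Y => //; rewrite -mE; exact: feas.
Qed.
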